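(* Let $G=(V,\mathcal D,\mathcal B)$ be an acyclic directed mixed graph with linear structural equation model covariance matrix $\Sigma$, let $a^*,b\in V$ with $a^*\to b\notin\mathcal D$ and such that adding the directed edge $a^*\to b$ to $G$ gives an acyclic directed mixed graph $G^*$, and let $\Sigma^*$ be the covariance matrix obtained by adding the directed edge $a^*\to b$, with a chosen edge coefficient $\lambda_{a^*b}$, to $G$. Let $C=\operatorname{de}(b)\setminus\{b\}$. Then $\Sigma^*$ is identifiable given $\Sigma$ if and only if $\sigma(\mathcal D_{bc})$ is identifiable for all $c\in C$.
   Context: An acyclic directed mixed graph (ADMG) $G=(V,\mathcal D,\mathcal B)$ has a finite vertex set $V$, a set $\mathcal D$ of directed edges and a set $\mathcal B$ of bidirected edges, with no loops and no directed cycles; a pair of vertices may be joined by both a directed and a bidirected edge. The parameter space $\Theta$ consists of pairs $(\Lambda,\Omega)$ where $\Lambda=(\lambda_{ij})\in\mathbb R^{V\times V}$ has $\lambda_{ij}=0$ unless $i\to j\in\mathcal D$, and $\Omega=(\omega_{ij})$ is symmetric positive definite with $\omega_{ij}=0$ unless $i=j$ or $i\leftrightarrow j\in\mathcal B$. The model covariance matrix is $\Sigma=\phi(\Lambda,\Omega)=(I-\Lambda)^{-T}\Omega(I-\Lambda)^{-1}$. $\operatorname{de}(v)$ is the set of descendants of $v$ in $G$, including $v$. $\mathcal D_{uv}$ is the set of directed paths from $u$ to $v$ in $G$, and $\sigma(\mathcal D_{uv})=\sum_{\tau\in\mathcal D_{uv}}\prod_{x\to y\in\tau}\lambda_{xy}$.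 Adding the edge $a^*\to b$ with coefficient $\lambda_{a^*b}\in\mathbb R$: $\Sigma^*=(I-\Lambda^* )^{-T}\Omega(I-\Lambda^* )^{-1}$, where $\Lambda^*$ is $\Lambda$ with its $(a^*,b)$ entry (which is $0$) replaced by $\lambda_{a^*b}$. The coefficient $\lambda_{a^*b}$ is freely chosen and regarded as known, so it need not be identified. Identifiability: a function $f$ on $\Theta$ is identifiable if for Lebesgue-almost all $\theta\in\Theta$ it is constant on the fibre $\phi^{-1}(\phi(\theta))$. ''$\Sigma^*$ is identifiable given $\Sigma$'' means that for Lebesgue-almost all $(\theta,\lambda_{a^*b})\in\Theta\times\mathbb R$, the matrix $\Sigma^*$, as a function of the model parameters with $\lambda_{a^*b}$ held fixed, is constant on the fibre $\phi^{-1}(\phi(\theta))$. *)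

(* Defs.v *)
From HB Require Import structures.
From mathcomp Require Import all_boot all_order all_algebra.
From mathcomp Require Import all_classical all_reals all_analysis.

Set Implicit Arguments.
Unset Strict Implicit.
Unset Printing Implicit Defensive.

Import Order.TTheory GRing.Theory Num.Theory.
Local Open Scope classical_set_scope.
Local Open Scope ring_scope.

(* Directed mixed graphs on the vertex set 'I_n, the index type of n x n
   matrices.  The two edge relations are independent, so a pair of vertices may
   carry both a directed and a bidirected edge. *)
Record mixed_graph (n : nat) := MixedGraph {
  dir : rel 'I_n;
  bidir : rel 'I_n
}.

(* [cycle e c] holds trivially for [c = [::]] and requires [e x x] for
   [c = [:: x]], so the acyclicity clause also excludes directed loops. *)
Definition is_admg n (G : mixed_graph n) : Prop :=
  [/\ forall c : seq 'I_n, cycle (dir G) c -> c = [::],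
      symmetric (bidir G) & irreflexive (bidir G)].

Definition add_dir n (G : mixed_graph n) (a b : 'I_n) : mixed_graph n :=
  MixedGraph [rel x y | dir G x y || ((x == a) && (y == b))] (bidir G).

Definition descendants n (G : mixed_graph n) (v : 'I_n) : set 'I_n :=
  [set w | connect (dir G) v w].

(* [p] encodes the directed path u -> p_1 -> ... -> p_k = v; the trivial path
   [p = [::]] occurs exactly when u = v. *)
Definition directed_paths n (G : mixed_graph n) (u v : 'I_n) :
    set (seq 'I_n) :=
  [set p | path (dir G) u p /\ last u p = v].

Section LebesgueNull.
Context {R : realType} {I : finType}.

Definition box (l u : {ffun I -> R}) : set {ffun I -> R} :=
  [set x | forall i, l i <= x i <= u i].

Definition box_volume (l u : {ffun I -> R}) : R := \prod_i (u i - l i).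

(* N is a null set for Lebesgue measure on R^I: for every e > 0 it is covered by
   countably many boxes of total volume at most e.  N is not assumed to be
   measurable. *)
Definition lebesgue_null (N : set {ffun I -> R}) : Prop :=
  forall e : R, 0 < e ->
  exists (K : set nat) (l u : nat -> {ffun I -> R}),
    [/\ forall k i, l k i <= u k i,
        N `<=` \bigcup_(k in K) box (l k) (u k) &
        (\esum_(k in K) (box_volume (l k) (u k))%:E <= e%:E)%E].

End LebesgueNull.

Section Model.
Context {R : realType} {n : nat}.

(* The pair (Lambda, Omega). *)
Definition params : Type := ('M[R]_n * 'M[R]_n)%type.

Definition posdef (A : 'M[R]_n) : Prop :=
  A^T = A /\ forall v : 'cV[R]_n, v != 0 -> 0 < (v^T *m A *m v) 0 0.

Definition Theta (G : mixed_graph n) : set params :=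
  [set th : params | [/\ forall i j, ~~ dir G i j -> th.1 i j = 0,
                posdef th.2 &
                forall i j : 'I_n, i != j -> ~~ bidir G i j -> th.2 i j = 0]].

Definition cov (th : params) : 'M[R]_n :=
  (invmx (1%:M - th.1))^T *m th.2 *m invmx (1%:M - th.1).

Definition set_coef (L : 'M[R]_n) (a b : 'I_n) (t : R) : 'M[R]_n :=
  \matrix_(i, j) (if (i == a) && (j == b) then t else L i j).

Definition cov_star (a b : 'I_n) (t : R) (th : params) : 'M[R]_n :=
  cov (set_coef th.1 a b t, th.2).

(* The sum has finite support when G is acyclic. *)
Definition path_sum (G : mixed_graph n) (u v : 'I_n) (th : params) : R :=
  \sum_(p \in directed_paths G u v)
    \prod_(w <- pairmap (fun x y => th.1 x y) u p) w.

(* The free entries of a parameter: lambda_ij for i -> j, and the entries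
   omega_ij, i <= j, of the symmetric matrix Omega with i = j or i <-> j.  In
   these coordinates Theta is an open subset of R^(free_entry G). *)
Definition free_entry (G : mixed_graph n) : finType :=
  ({e : 'I_n * 'I_n | dir G e.1 e.2} +
   {e : 'I_n * 'I_n |
      (e.1 <= e.2)%N && ((e.1 == e.2) || bidir G e.1 e.2)})%type.

Definition coords (G : mixed_graph n) (th : params) :
    {ffun free_entry G -> R} :=
  [ffun k => match k with
             | inl e => th.1 (val e).1 (val e).2
             | inr e => th.2 (val e).1 (val e).2
             end].

Definition coords_ext (G : mixed_graph n) (tht : params * R) :
    {ffun option (free_entry G) -> R} :=
  [ffun k => if k is Some k' then coords G tht.1 k' else tht.2].

Definition almost_all_Theta (G : mixed_graph n) (P : params -> Prop) : Prop :=
  lebesgue_null (coords G @` [set th : params | Theta G th /\ ~ P th]).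

Definition almost_all_Theta_R (G : mixed_graph n)
    (P : params -> R -> Prop) : Prop :=
  lebesgue_null
    (coords_ext G @` [set tht : params * R | Theta G tht.1 /\ ~ P tht.1 tht.2]).

Definition fibre (G : mixed_graph n) (S : 'M[R]_n) : set params :=
  [set th : params | Theta G th /\ cov th = S].

Definition constant_on (T : Type) (A : set params) (f : params -> T) : Prop :=
  forall th1 th2, A th1 -> A th2 -> f th1 = f th2.

Definition identifiable (G : mixed_graph n) (T : Type) (f : params -> T) :
    Prop :=
  almost_all_Theta G (fun th => constant_on (fibre G (cov th)) f).

Definition cov_star_identifiable (G : mixed_graph n) (a b : 'I_n) : Prop :=
  almost_all_Theta_R G
    (fun th t => constant_on (fibre G (cov th)) (cov_star a b t)).

End Model.

Arguments params : clear implicits.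
Arguments cov_star_identifiable R {n} G a b.

(* Main.v *)
Require Import Defs.
From mathcomp Require Import all_boot all_order all_algebra.
From mathcomp Require Import all_classical all_reals all_analysis.
From mathcomp Require Import measurable_realfun.

(* Let M = (1 - Lambda)^-1, whose (u, v) entry is the path sum sigma(D_uv), and
   let r be the row b of M.  As a is not a descendant of b, adding a -> b with
   coefficient t turns M into M T with T = 1 + t e_a r, so Sigma* = T^T Sigma T.
   Hence Sigma and r determine Sigma*; conversely r_a = 0 gives
   Sigma*_ac = Sigma_ac + t Sigma_aa r_c with Sigma_aa > 0, so for t <> 0 the
   matrices Sigma and Sigma* determine r.  The null sets of Theta and of
   Theta x R are compared by the two halves of a Tonelli argument, carried out
   directly on coverings by boxes because the exceptional sets are not known to
   be measurable. *)

Set Implicit Arguments.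
Unset Strict Implicit.
Unset Printing Implicit Defensive.

Import Order.TTheory GRing.Theory Num.Theory.
Local Open Scope classical_set_scope.
Local Open Scope ring_scope.

(** * Null sets through coverings by boxes *)

Section Null.
Context {R : realType}.

Lemma esum_series (K : set nat) (f : nat -> \bar R) : (forall k, 0 <= f k)%E ->
  (\esum_(k in K) f k = \sum_(k <oo | k \in K) f k)%E.
Proof.
by move=> f0; rewrite (nneseries_esum (P := fun k => k \in K)) ?set_mem_set.
Qed.

Lemma box_volume_ge0 (I : finType) (l u : {ffun I -> R}) :
  (forall i, l i <= u i) -> 0 <= box_volume l u.
Proof. by move=> lu; apply: prodr_ge0 => i _; rewrite subr_ge0. Qed.

Lemma box_volume_option (I : finType) (l u : {ffun option I -> R}) :
  box_volume l u = (u None - l None) *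
    box_volume [ffun i => l (Some i)] [ffun i => u (Some i)].
Proof.
rewrite /box_volume (bigD1 None) //=; congr (_ * _).
rewrite (reindex_omap Some id) => [|[i|]] //=.
by apply: eq_big => [i|i _]; rewrite ?eqxx ?ffunE.
Qed.

Lemma lebesgue_null_sub (I : finType) (A B : set {ffun I -> R}) :
  A `<=` B -> lebesgue_null B -> lebesgue_null A.
Proof.
move=> AB B0 e /B0[K [l [u [lu BK vol]]]].
by exists K, l, u; split=> //; apply: subset_trans BK.
Qed.

Lemma lebesgue_null_set0 (I : finType) : lebesgue_null (set0 : set {ffun I -> R}).
Proof.
move=> e e0; exists set0, (fun=> 0), (fun=> 0); split=> //.
by rewrite esum_set0 lee_fin ltW.
Qed.

(** Cover the [m]-th set with volume at most [e / 2 ^ (m + 1)] and merge the coverings into one,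
    indexed by codes of pairs [(m, k)]. *)
Lemma lebesgue_null_bigcup (I : finType) (N : nat -> set {ffun I -> R}) :
  (forall m, lebesgue_null (N m)) -> lebesgue_null (\bigcup_m N m).
Proof.
move=> N0 e e0.
have e_gt0 m : 0 < e / (2 ^ m.+1)%:R by rewrite divr_gt0 // ltr0n expn_gt0.
have /choice[c cP] : forall m, exists c : set nat *
    (nat -> {ffun I -> R}) * (nat -> {ffun I -> R}),
    [/\ forall k i, c.1.2 k i <= c.2 k i,
        N m `<=` \bigcup_(k in c.1.1) box (c.1.2 k) (c.2 k) &
        (\esum_(k in c.1.1) (box_volume (c.1.2 k) (c.2 k))%:E
           <= (e / (2 ^ m.+1)%:R)%:E)%E].
  by move=> m; have [K [l [u cov]]] := N0 m _ (e_gt0 m); exists (K, l, u).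
(* The default [0] makes degenerate boxes at non-codes; these lie outside the index set used
   below. *)
pose corner (f : nat -> nat -> {ffun I -> R}) p : {ffun I -> R} :=
  if unpickle p is Some (m, k) then f m k else 0.
exists (pickle @` ([set: nat] `*`` (fun m => (c m).1.1))),
  (corner (fun m => (c m).1.2)), (corner (fun m => (c m).2)); split.
- move=> p i; rewrite /corner; case: unpickle => [[m k]|//].
  by have [+ _ _] := cP m; apply.
- move=> x [m _ Nx]; have [_ /(_ _ Nx)[k Kk xB] _] := cP m.
  exists (pickle (m, k)); first by exists (m, k).
  by rewrite /corner pickleK.
- rewrite esum_image; last by move=> x y _ _; exact: (pcan_inj pickleK).
  under eq_esum do rewrite /corner pickleK.
  rewrite [leLHS](_ : _ = \esum_(m in [set: nat]) \esum_(k in (c m).1.1)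
      (box_volume ((c m).1.2 k) ((c m).2 k))%:E)%E; last first.
    rewrite esum_esum; first by apply: eq_esum => -[].
    by move=> m k _ _; rewrite lee_fin box_volume_ge0 //; have [] := cP m.
  apply: le_trans (epsilon_trick0 xpredT (ltW e0)).
  rewrite nneseries_esumT; last by move=> m; rewrite lee_fin ltW.
  by apply: le_esum => m _; have [] := cP m.
Qed.

Lemma lebesgue_null_bigcup_countable (I : finType) (J : countType)
    (D : set J) (N : J -> set {ffun I -> R}) :
  (forall j, D j -> lebesgue_null (N j)) -> lebesgue_null (\bigcup_(j in D) N j).
Proof.
move=> N0; pose N' m := if unpickle m is Some j then
  if asbool (D j) then N j else set0 else set0.
apply: (@lebesgue_null_sub _ _ (\bigcup_m N' m)).
  move=> x [j Dj Nx]; exists (pickle j) => //; rewrite /N' pickleK.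
  by case: asboolP.
apply: lebesgue_null_bigcup => m; rewrite /N'.
case: unpickle => [j|]; last exact: lebesgue_null_set0.
by case: asboolP => [/N0|_] //; exact: lebesgue_null_set0.
Qed.

Lemma lebesgue_null_cylinder (I : finType) (N : set {ffun I -> R}) :
  lebesgue_null N ->
  lebesgue_null [set y : {ffun option I -> R} | N [ffun i => y (Some i)]].
Proof.
(* A covering of [N] times a bounded interval has finite total volume, so the cylinder is cut into
   slabs of bounded height. *)
move=> N0; pose slab m := [set y : {ffun option I -> R} |
  N [ffun i => y (Some i)] /\ `|y None| <= m%:R].
apply: (@lebesgue_null_sub _ _ (\bigcup_m slab m)).
  move=> y Ny; exists (Num.truncn `|y None|).+1 => //; split=> //.
  by rewrite ltW // truncnS_gt.
apply: lebesgue_null_bigcup => m e e0.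
(* Half-height [m + 1] instead of [m] keeps the divisor positive at [m = 0]. *)
have m2_gt0 : 0 < (m.+1%:R *+ 2 : R) by rewrite mulrn_wgt0 // ltr0n.
have [K [l [u [lu NK vol]]]] := N0 _ (divr_gt0 e0 m2_gt0).
pose ext (c : R) (v : {ffun I -> R}) : {ffun option I -> R} :=
  [ffun o => if o is Some i then v i else c].
exists K, (fun k => ext (- m.+1%:R) (l k)), (fun k => ext m.+1%:R (u k)); split.
- move=> k [i|]; rewrite !ffunE //.
  by rewrite lerNl (le_trans (y := 0)) // oppr_le0.
- move=> y [/NK[k Kk yB] ym]; exists k => // -[i|]; rewrite !ffunE.
    by have := yB i; rewrite ffunE.
  by rewrite -ler_norml (le_trans ym) // ler_nat.
- have volE k : box_volume (ext (- m.+1%:R) (l k)) (ext m.+1%:R (u k)) =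
      (m.+1%:R *+ 2) * box_volume (l k) (u k).
    rewrite box_volume_option !ffunE opprK mulr2n; congr (_ * box_volume _ _);
    by apply/ffunP => i; rewrite !ffunE.
  under eq_esum do rewrite volE EFinM.
  have vol_ge0 k : (0 <= (box_volume (l k) (u k))%:E)%E.
    by rewrite lee_fin box_volume_ge0.
  rewrite esum_series; last by move=> k; rewrite mule_ge0 // lee_fin ltW.
  rewrite nneseriesZl // -esum_series //.
  by rewrite muleC -lee_pdivlMr.
Qed.

(* The slices of a cover of N x [c, d] at the heights t are covers of N whose
   total volumes average, over t in [c, d], to at most that of the given cover
   divided by d - c; so one of them is small. *)
Lemma lebesgue_null_of_slab (I : finType) (N : set {ffun I -> R}) (c d : R) :
  c < d ->
  lebesgue_null [set y : {ffun option I -> R} |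
    N [ffun i => y (Some i)] /\ c <= y None <= d] ->
  lebesgue_null N.
Proof.
move=> cd slab0 e e0; have dc : 0 < d - c by rewrite subr_gt0.
(* The factor [1 / 2] makes the bound strictly smaller than [(d - c) * e], which contradicts every
   slice having volume above [e]. *)
have [|K [l [u [lu slabK vol]]]] := slab0 ((d - c) * (e / 2)).
  by rewrite mulr_gt0 ?divr_gt0.
pose res (v : {ffun option I -> R}) : {ffun I -> R} := [ffun i => v (Some i)].
pose w k := box_volume (res (l k)) (res (u k)).
have w_ge0 k : 0 <= w k.
  by apply: box_volume_ge0 => i; rewrite !ffunE.
pose J k : set R := [set` `[l k None, u k None]].
pose slice (t : R) := K `&` [set k | J k t].
suff [t ct small] : exists2 t, c <= t <= d & (\esum_(k in slice t) (w k)%:E <= e%:E)%E.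
  exists (slice t), (res \o l), (res \o u); split=> //.
    by move=> k i; rewrite !ffunE.
  move=> x Nx.
  have [|k Kk /= xB] :=
      slabK [ffun o => if o is Some i then x i else t]; rewrite /= ?ffunE.
    by split=> //; rewrite (_ : [ffun i => _] = x) //; apply/ffunP => i; rewrite !ffunE.
  exists k; first by split=> //; have := xB None; rewrite ffunE /= /J /= in_itv.
  by move=> i /=; have := xB (Some i); rewrite !ffunE.
apply: contrapT => large.
(* Contribution of box [k] to the slice at height [t]: a constant times the indicator of an
   interval, hence measurable in [t] whatever [N] is. *)
pose h k (t : R) : \bar R := ((if k \in K then w k else 0)%:E * (\1_(J k) t)%:E)%E.
have h_ge0 k t : (0 <= h k t)%E.
  by rewrite mule_ge0 // lee_fin //; case: ifP.
have sliceE t : (\esum_(k in slice t) (w k)%:E = \sum_(k <oo) h k t)%E.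
  rewrite esum_mkcond nneseries_esumT //; apply: eq_esum => k _.
  rewrite /h indicE in_setI; case: (k \in K) => /=; last by rewrite mul0e.
  rewrite (_ : (k \in [set k | J k t]) = (t \in J k)); last first.
    by apply/idP/idP; rewrite !inE.
  by case: ifP; rewrite ?mule1 ?mule0.
pose D : set R := [set` `[c, d]].
have mD : measurable D by exact: measurable_itv.
have mJ k : measurable (J k : set R) by exact: measurable_itv.
have m1J k : measurable_fun D (fun t => (\1_(J k) t)%:E : \bar R).
  by apply/measurable_EFinP; apply: measurable_indic.
have mh k : measurable_fun D (h k).
  exact: measurable_funeM.
pose mu := @lebesgue_measure R.
have muD : mu D = (d - c)%:E.
  by rewrite /mu /D lebesgue_measure_itv /= lte_fin cd.
have int_h k : (\int[mu]_(t in D) h k t <=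
    if k \in K then (box_volume (l k) (u k))%:E else 0)%E.
  have w0 : (0 <= (if k \in K then w k else 0)%:E)%E.
    by rewrite lee_fin; case: ifP.
  rewrite (ge0_integralZl mu mD (m1J k)) //.
  rewrite (integral_indic mu mD (mJ k)); case: (k \in K) => /=; last by rewrite mul0e.
  rewrite box_volume_option mulrC EFinM lee_wpmul2l ?lee_fin //.
  (* Only an inequality, since box [k] may stick out of the slab. *)
  apply: le_trans (_ : mu (J k) <= _)%E.
    apply: le_measure; rewrite ?inE //=; last exact: mJ.
    by apply: measurableI => //; exact: mJ.
  rewrite /mu /J lebesgue_measure_itv /= lte_fin.
  by case: ifP => // _; rewrite lee_fin subr_ge0.
(* Integrate the lower bound [e] on the slices over [D], then exchange sum and integral. *)
have : ((e * (d - c))%:E <= ((d - c) * (e / 2))%:E)%E.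
  apply: le_trans vol.
  rewrite EFinM -muD -integral_cst //.
  apply: le_trans (_ : \int[mu]_(t in D) \sum_(k <oo) h k t <= _)%E.
    apply: ge0_le_integral => //.
    - by move=> t _; rewrite lee_fin ltW.
    - by apply: ge0_emeasurable_sum => // k _; exact: mh.
    - move=> t; rewrite /D /= in_itv /= => cdt; rewrite -sliceE leNgt.
      by apply/negP => /ltW small; apply: large; exists t.
  rewrite integral_nneseries // esum_mkcond -nneseries_esumT; last first.
    by move=> k; case: ifP => // _; rewrite lee_fin box_volume_ge0.
  apply: lee_nneseries => [k _ _|k _]; last exact: int_h.
  by apply: integral_ge0 => t _; exact: h_ge0.
rewrite lee_fin mulrC ler_pM2l // => ee2.
have : e / 2 < e by rewrite ltr_pdivrMr // ltr_pMr // ltr1n.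
by rewrite ltNge ee2.
Qed.

End Null.

(** * Directed paths in an acyclic graph and their enumeration *)

Lemma cycle_of_closed_path (T : eqType) (e : rel T) (x y : T) (p : seq T) :
  e x y -> path e y p -> last y p = x -> cycle e (x :: belast y p).
Proof.
move=> exy yp xE; rewrite /cycle -[X in rcons _ X]xE -lastI /=.
by rewrite exy.
Qed.

Lemma closed_path_nil n (G : mixed_graph n) (u : 'I_n) (p : seq 'I_n) :
  is_admg G -> path (dir G) u p -> last u p = u -> p = [::].
Proof.
move=> [acyc _ _]; case: p => // w p /= /andP[uw wp] /(cycle_of_closed_path uw wp).
by move=> /acyc.
Qed.

(** The segment up to a return to the start would be a nonempty closed path. This bounds the length
    of all directed paths. *)
Lemma directed_path_uniq n (G : mixed_graph n) (u : 'I_n) (p : seq 'I_n) :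
  is_admg G -> path (dir G) u p -> uniq (u :: p).
Proof.
move=> hG; elim: p u => // w p IH u uwp.
have /andP[_ wp] := uwp.
rewrite cons_uniq IH // andbT; apply/negP => uin.
move: uwp; case/splitPr: uin => p1 p2.
rewrite -cat1s catA cat_path => /andP[+ _].
move=> /(closed_path_nil hG); rewrite last_cat /= => /(_ erefl).
by case: p1.
Qed.

(** Recursion on the length bound, so that a sum over paths unfolds along the first edge. *)
Fixpoint bounded_paths (T : finType) (e : rel T) (k : nat) (u : T) : seq (seq T) :=
  if k is k'.+1 then
    [::] :: [seq w :: p | w <- enum (e u), p <- bounded_paths e k' w]
  else [:: [::]].

Lemma mem_bounded_paths (T : finType) (e : rel T) k u p :
  (p \in bounded_paths e k u) = path e u p && (size p <= k)%N.
Proof.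
elim: k u p => [|k IH] u [|w p] //=; rewrite inE ?andbF //=.
apply/allpairsPdep/idP => [[w' [p' [+ + [-> ->]]]]|/andP[/andP[uw wp] sp]].
  by rewrite mem_enum IH => uw /andP[-> sp]; rewrite andbT; apply/andP.
by exists w, p; rewrite mem_enum IH wp.
Qed.

Lemma bounded_paths_uniq (T : finType) (e : rel T) k u :
  uniq (bounded_paths e k u).
Proof.
elim: k u => //= k IH u; apply/andP; split.
  by apply/allpairsPdep => -[w [p [_ _]]].
apply: allpairs_uniq_dep => // [|[w p] [w' p'] _ _ [-> ->] //].
exact: enum_uniq.
Qed.

(** * Path sums as the inverse of [1 - Lambda] *)

Section PathSum.
Context {R : realType} {n : nat} (G : mixed_graph n) (hG : is_admg G).

(** Repetition-free paths have fewer than [n] edges. The bound [k] stays free because the recursion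
    below compares the bounds [n + 1] and [n]. *)
Lemma path_sum_bounded (u v : 'I_n) (th : params R n) k : (n <= k)%N ->
  path_sum G u v th = \sum_(p <- bounded_paths (dir G) k u | last u p == v)
    \prod_(w <- pairmap (fun x y => th.1 x y) u p) w.
Proof.
move=> nk; rewrite /path_sum -[RHS]big_filter.
rewrite [RHS]fsbig_seq ?filter_uniq ?bounded_paths_uniq//.
apply: eq_fsbigl; apply/seteqP; split=> p /=.
  move=> [up <-]; rewrite mem_filter eqxx mem_bounded_paths up /=.
  have /card_uniqP /= pE := directed_path_uniq hG up.
  have := max_card (mem (u :: p)); rewrite card_ord pE => pn.
  by rewrite (leq_trans _ nk) // ltnW.
by rewrite mem_filter mem_bounded_paths => /andP[/eqP ? /andP[]].
Qed.

(** Split off the trivial path, and sort the others by their first edge. *)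
Lemma path_sum_rec (u v : 'I_n) (th : params R n) :
  (forall i j, ~~ dir G i j -> th.1 i j = 0) ->
  path_sum G u v th =
    (u == v)%:R + \sum_w th.1 u w * path_sum G w v th.
Proof.
move=> th0; rewrite (path_sum_bounded _ _ _ (leqnSn n)) /= big_mkcond big_cons.
congr (_ + _); first by rewrite /= big_nil; case: eqP.
rewrite big_allpairs_dep /= big_enum /= big_mkcond; apply: eq_bigr => w _.
case: ifPn => [_|/th0->]; last by rewrite mul0r.
rewrite (path_sum_bounded _ _ _ (leqnn n)) mulr_sumr [RHS]big_mkcond.
by apply: eq_bigr => p _; case: ifP => //; rewrite big_cons.
Qed.

Lemma path_sum_inv (th : params R n) :
  (forall i j, ~~ dir G i j -> th.1 i j = 0) ->
  (1%:M - th.1) *m (\matrix_(u, v) path_sum G u v th) = 1%:M.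
Proof.
move=> th0; apply/matrixP => u v; rewrite mulmxBl mul1mx !mxE path_sum_rec //.
by under [X in _ - X]eq_bigr do rewrite mxE; rewrite addrK.
Qed.

Lemma path_sum_self (u : 'I_n) (th : params R n) : path_sum G u u th = 1.
Proof.
rewrite /path_sum (_ : directed_paths G u u = [set [::]]).
  by rewrite fsbig_set1 big_nil.
by apply/seteqP; split=> p /= => [[/(closed_path_nil hG)]|->].
Qed.

Lemma path_sum_eq0 (u v : 'I_n) (th : params R n) :
  ~~ connect (dir G) u v -> path_sum G u v th = 0.
Proof.
move=> uv; rewrite /path_sum (_ : directed_paths G u v = set0) ?fsbig_set0 //.
apply/seteqP; split=> // p [up pE]; case/negP: uv.
by apply/connectP; exists p.
Qed.

End PathSum.

(** * Inverse entries and positive variances *)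

Section Covariance.
Context {R : realType} {n : nat} (G : mixed_graph n) (hG : is_admg G).
Context (th : params R n) (hth : Theta G th).

Let hth0 i j : ~~ dir G i j -> th.1 i j = 0.
Proof. by have [+ _ _] := hth; apply. Qed.

Lemma unitmx_subr_coef : 1%:M - th.1 \in unitmx.
Proof. by have [] := mulmx1_unit (path_sum_inv hG hth0). Qed.

Lemma path_sumE u v : path_sum G u v th = invmx (1%:M - th.1) u v.
Proof.
have := congr1 (mulmx (invmx (1%:M - th.1))) (path_sum_inv hG hth0).
by rewrite mulKmx ?unitmx_subr_coef // mulmx1 => <-; rewrite mxE.
Qed.

(** The variance is the quadratic form of [Omega] at column [v] of the inverse, which is nonzero as
    a column of an invertible matrix. *)
Lemma cov_gt0 (v : 'I_n) : 0 < cov th v v.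
Proof.
have [_ [_ pos] _] := hth.
set M := invmx (1%:M - th.1).
have -> : cov th v v = ((col v M)^T *m th.2 *m col v M) 0 0.
  rewrite tr_col -row_mul mxE [RHS]mxE; apply: eq_bigr => k _.
  by rewrite [row _ _ _ _]mxE [col _ _ _ _]mxE.
apply: pos; apply/eqP => Mv0.
have : (1%:M - th.1) *m (M *m delta_mx v (0 : 'I_1)) = 0.
  by rewrite -colE Mv0 mulmx0.
rewrite mulKVmx ?unitmx_subr_coef // => /colP /(_ v) /eqP.
by rewrite !mxE !eqxx oner_eq0.
Qed.

End Covariance.

(* Adding a -> b perturbs 1 - Lambda by a rank-one matrix.  Since a is not a
   descendant of b, the Sherman-Morrison correction has denominator 1. *)
Lemma invmx_set_coef (R : realType) n (L : 'M[R]_n) (a b : 'I_n) (t : R) :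
  1%:M - L \in unitmx -> L a b = 0 -> invmx (1%:M - L) b a = 0 ->
  invmx (1%:M - set_coef L a b t) =
    invmx (1%:M - L) *m (1%:M + t *: (delta_mx a 0 *m row b (invmx (1%:M - L)))).
Proof.
set A := 1%:M - L; set M := invmx A => A_unit Lab Mba.
set r := row b M; set e : 'cV_n := delta_mx a 0.
have AstarE : 1%:M - set_coef L a b t = A - t *: (e *m delta_mx 0 b).
  apply/matrixP => i j; rewrite mul_delta_mx !mxE -addrA -opprD; congr (_ - _).
  case: eqP => [->|_]; case: eqP => [->|_] /=; rewrite ?mulr0 ?addr0 //.
  by rewrite Lab mulr1 add0r.
(* This product is the entry [M b a]; its vanishing removes the term quadratic in [t]. *)
have re : r *m e = 0.
  by apply/matrixP => i j; rewrite !ord1 -colE !mxE.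
have inv : (1%:M - set_coef L a b t) *m (M *m (1%:M + t *: (e *m r))) = 1%:M.
  rewrite AstarE mulmxA mulmxBl mulmxV // -scalemxAl -mulmxA -rowE -/r.
  rewrite mulmxBl mul1mx mulmxDr mulmx1.
  rewrite -scalemxAl -scalemxAr -mulmxA [r *m _]mulmxA re mul0mx mulmx0.
  by rewrite !scaler0 addr0 addrK.
have [u _] := mulmx1_unit inv.
by rewrite -[RHS](mulKmx u) inv mulmx1.
Qed.

(** * The covariance matrix after adding the edge *)

Section CovStar.
Context {R : realType} {n : nat} (G : mixed_graph n) (a b : 'I_n).
Context (hG : is_admg G) (hab : ~~ dir G a b) (hGs : is_admg (add_dir G a b)).

(** A path from [b] to [a] would close up with the new edge to a cycle. *)
Lemma add_dir_not_connect : ~~ connect (dir G) b a.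
Proof.
apply/connectP => -[p bp pE]; have [acyc _ _] := hGs.
suff /acyc : cycle (dir (add_dir G a b)) (a :: belast b p) by [].
apply: cycle_of_closed_path => //=; first by rewrite !eqxx orbT.
by apply: sub_path bp => x y /= ->.
Qed.

Lemma cov_starE (t : R) (th : params R n) : Theta G th ->
  let T := 1%:M + t *: (delta_mx a 0 *m \row_c path_sum G b c th) in
  cov_star a b t th = T^T *m cov th *m T.
Proof.
move=> hth T; have [th0 _ _] := hth; rewrite /cov_star /cov /=.
rewrite invmx_set_coef ?(unitmx_subr_coef hG hth) //; last 2 first.
- exact: th0.
- by rewrite -(path_sumE hG hth) path_sum_eq0 // add_dir_not_connect.
rewrite (_ : row b _ = \row_c path_sum G b c th); last first.
  by apply/rowP => c; rewrite !mxE (path_sumE hG hth).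
by rewrite -/T trmx_mul !mulmxA.
Qed.

Lemma cov_star_row (t : R) (th : params R n) (c : 'I_n) : Theta G th ->
  cov_star a b t th a c = cov th a c + t * cov th a a * path_sum G b c th.
Proof.
move=> hth; rewrite cov_starE //= -mulmxA.
set r := (X in delta_mx a 0 *m X); set S := cov th.
have ra : r 0 a = 0 by rewrite mxE path_sum_eq0 // add_dir_not_connect.
(* The left factor adds multiples of row [a] to the rows; row [a] itself is unchanged since
   [r 0 a = 0]. *)
have -> i j X : ((1%:M + t *: (delta_mx a 0 *m r))^T *m X) i j =
    X i j + t * r 0 i * X a j.
  rewrite linearD /= linearZ /= trmx_mul trmx1 mulmxDl mul1mx mxE.
  by rewrite trmx_delta -scalemxAl -mulmxA -rowE !mxE big_ord1 !mxE mulrA.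
rewrite ra mulr0 mul0r addr0 mulmxDr mulmx1 mxE -scalemxAr mulmxA -colE.
by rewrite !mxE big_ord1 !mxE mulrA.
Qed.

End CovStar.

(** * Comparison of the exceptional sets *)

Theorem proposition4p1 (R : realType) (n : nat) (G : mixed_graph n)
    (a b : 'I_n) (hG : is_admg G) (hab : ~~ dir G a b)
    (hGs : is_admg (add_dir G a b)) :
  cov_star_identifiable R G a b <->
  (forall c : 'I_n, (descendants G b `\ b) c ->
     identifiable G (fun th : params R n => path_sum G b c th)).
Proof.
have coords_extE (th : params R n) t :
    [ffun i => coords_ext G (th, t) (Some i)] = coords G th.
  by apply/ffunP => i; rewrite !ffunE.
split=> [star0 c _|r0].
(* Any interval avoiding [0] would do: [t] has to be cancelled. *)
- apply: (@lebesgue_null_of_slab _ _ _ 1 2); first by rewrite ltr1n.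
  apply: lebesgue_null_sub star0 => y [[th [hth r_var] thE] /andP[y1 _]].
  have t0 : y None != 0 by rewrite gt_eqF // (lt_le_trans ltr01).
  exists (th, y None); last first.
    apply/ffunP => -[i|]; rewrite !ffunE //=.
    by have /ffunP/(_ i) := thE; rewrite !ffunE.
  split=> //= star_cst; apply: r_var => th1 th2 F1 F2.
  have [hth1 S1] := F1; have [hth2 S2] := F2.
  have := star_cst _ _ F1 F2 => /matrixP /(_ a c).
  rewrite (cov_star_row hG hab hGs _ _ hth1) (cov_star_row hG hab hGs _ _ hth2).
  rewrite S1 S2 => /addrI; apply: mulfI.
  by rewrite mulf_neq0 // gt_eqF // (cov_gt0 hG hth).
(* The exceptional set lies in the union over [c] of the cylinders above the exceptional sets of the
   path sums. *)
- apply: lebesgue_null_sub (lebesgue_null_bigcup_countable (fun c hc =>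
    lebesgue_null_cylinder (r0 c hc))) => _ [[th t] [/= hth star_var] <-].
  apply: contrapT => r_cst; apply: star_var => th1 th2 F1 F2.
  have [hth1 S1] := F1; have [hth2 S2] := F2.
  rewrite (cov_starE hG hab hGs _ hth1) (cov_starE hG hab hGs _ hth2) S1 S2.
  suff -> : \row_c path_sum G b c th1 = \row_c path_sum G b c th2 by [].
  apply/rowP => c; rewrite !mxE.
  (* Outside [C] the row is constant: [1] at [b] and [0] at non-descendants. *)
  have [<-|bc] := eqVneq b c; first by rewrite !path_sum_self.
  have [desc|ndesc] := boolP (connect (dir G) b c); last by rewrite !path_sum_eq0.
  apply: contrapT => r_neq; apply: r_cst; exists c.
    by split=> //= cb; rewrite cb eqxx in bc.
  by exists th; [split=> // /(_ _ _ F1 F2)|rewrite coords_extE].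
Qed.
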